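(* Let $G$ be a finite group. For every $w\in\mathrm{Aut}_c(G)$, the linear maps $e_g\# h\mapsto e_g\# w(h)$ and $e_g\# h\mapsto e_{w(g)}\# h$ are elements of $\mathrm{Aut}(\mathcal{D}(G))$. In particular, these give two distinct injective group homomorphisms $\mathrm{Aut}_c(G)\to\mathrm{Aut}(\mathcal{D}(G))$ whose images intersect trivially.
   Context: The base field $\mathbbm{k}$ is algebraically closed of characteristic zero. For a finite group $G$, $\mathbbm{k}^G$ is the linear dual of $\mathbbm{k}G$, with dual basis $\{e_g\}_{g\in G}$ and identity $\varepsilon=\sum_{g}e_g$. The Drinfeld double $\mathcal{D}(G)$ is the Hopf algebra with basis $e_g\# h$ ($g,h\in G$), multiplication $(e_g\# g')(e_h\# h')=\delta_{g,\,g'hg'^{-1}}\,e_g\# g'h'$, unit $\varepsilon\# 1$, and coalgebra structure $(\mathbbm{k}^G)^{\mathrm{cop}}\otimes\mathbbm{k}G$. $\mathrm{Aut}(\mathcal{D}(G))$ is its group of Hopf algebra automorphisms. $\mathrm{Aut}_c(G)=\{\phi\in\mathrm{Aut}(G):\phi(g)g^{-1}\in Z(G)\text{ for all }g\in G\}$. (''Distinct'' is understood when $\mathrm{Aut}_c(G)\neq1$.) *)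

(* Defs.v *)
From HB Require Import structures.
From mathcomp Require Import all_boot all_fingroup all_algebra.
From mathcomp Require Import center.
From mathcomp Require Import boolp.

Set Implicit Arguments.
Unset Strict Implicit.
Unset Printing Implicit Defensive.

Import GRing.Theory.
Local Open Scope ring_scope.

(* The free module on a finite type I is {ffun I -> k^o}; the tensor product    *)
(* of the free modules on I and J is the free module on I * J, with           *)
(* tens (bas i) (bas j) = bas (i, j).                                         *)
Section FreeModule.
Variable k : fieldType.

Definition bas (I : finType) (i : I) : {ffun I -> k^o} := [ffun j => (j == i)%:R].

Definition linext (I : finType) (V : lmodType k) (F : I -> V)
  (x : {ffun I -> k^o}) : V := \sum_i x i *: F i.

Definition tens (I J : finType) (x : {ffun I -> k^o}) (y : {ffun J -> k^o}) :
  {ffun I * J -> k^o} := [ffun p => x p.1 * y p.2].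

Definition tensmap (I J I' J' : finType)
    (f : {ffun I -> k^o} -> {ffun I' -> k^o}) (g : {ffun J -> k^o} -> {ffun J' -> k^o}) :
  {ffun I * J -> k^o} -> {ffun I' * J' -> k^o} :=
  linext (fun p => tens (f (bas p.1)) (g (bas p.2))).

Lemma regscaleE (a : k) (b : k^o) : a *: b = a * b.
Proof. by []. Qed.

Lemma linext_linear (I : finType) (V : lmodType k) (F : I -> V) : linear (linext F).
Proof.
move=> a x y; rewrite /linext scaler_sumr -big_split /=.
by apply: eq_bigr => i _; rewrite !ffunE scalerDl scalerA.
Qed.

HB.instance Definition _ (I : finType) (V : lmodType k) (F : I -> V) :=
  GRing.isLinear.Build k {ffun I -> k^o} V *:%R
  (@linext I V F) (linext_linear F).

HB.instance Definition _ (I J I' J' : finType)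
    (f : {ffun I -> k^o} -> {ffun I' -> k^o})
    (g : {ffun J -> k^o} -> {ffun J' -> k^o}) :=
  GRing.Linear.copy (tensmap f g)
    (linext (fun p => tens (f (bas p.1)) (g (bas p.2)))).

Lemma linext_bas (I : finType) (V : lmodType k) (F : I -> V) i : linext F (bas i) = F i.
Proof.
rewrite /linext (bigD1 i) //= ffunE eqxx scale1r big1 ?addr0 // => j /negPf ji.
by rewrite ffunE ji scale0r.
Qed.

Lemma bas_sum (I : finType) (x : {ffun I -> k^o}) : x = \sum_i x i *: bas i.
Proof.
apply/ffunP => j; rewrite sum_ffunE (bigD1 j) //= !ffunE eqxx regscaleE mulr1.
by rewrite big1 ?addr0 // => i /negPf ij; rewrite !ffunE eq_sym ij regscaleE mulr0.
Qed.

Lemma eq_on_bas (I : finType) (V : lmodType k) (f g : {ffun I -> k^o} -> V) :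
  linear f -> linear g -> (forall i, f (bas i) = g (bas i)) -> f =1 g.
Proof.
move=> lf lg fg x.
pose F : {linear _ -> _} := HB.pack f (GRing.isLinear.Build _ _ _ _ f lf).
pose G : {linear _ -> _} := HB.pack g (GRing.isLinear.Build _ _ _ _ g lg).
rewrite -[f]/(F : _ -> _) -[g]/(G : _ -> _) (bas_sum x) !linear_sum.
by apply: eq_bigr => i _; rewrite !linearZ /= fg.
Qed.

Lemma tens_linearl (I J : finType) (y : {ffun J -> k^o}) :
  linear (fun x : {ffun I -> k^o} => tens x y).
Proof. by move=> a u v; apply/ffunP => p; rewrite !ffunE !regscaleE mulrDl mulrA. Qed.

Lemma tens_linearr (I J : finType) (x : {ffun I -> k^o}) :
  linear (fun y : {ffun J -> k^o} => tens x y).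
Proof. by move=> a u v; apply/ffunP => p; rewrite !ffunE !regscaleE mulrDr mulrCA. Qed.

Lemma tens_bas (I J : finType) (i : I) (j : J) :
  tens (bas i) (bas j) = bas (i, j).
Proof.
by apply/ffunP => -[a b]; rewrite !ffunE /= -natrM mulnb xpair_eqE.
Qed.

Lemma tensmap_tens (I J I' J' : finType)
    (f : {ffun I -> k^o} -> {ffun I' -> k^o}) (g : {ffun J -> k^o} -> {ffun J' -> k^o})
    x y :
  linear f -> linear g -> tensmap f g (tens x y) = tens (f x) (g y).
Proof.
move=> lf lg.
apply: (eq_on_bas (f := fun x => tensmap f g (tens x y))
                  (g := fun x => tens (f x) (g y))).
- by move=> a u v; rewrite tens_linearl linearP.
- by move=> a u v; rewrite lf tens_linearl.
move=> i; apply: (eq_on_bas (f := fun y => tensmap f g (tens (bas i) y))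
                  (g := fun y => tens (f (bas i)) (g y))).
- by move=> a u v; rewrite tens_linearr linearP.
- by move=> a u v; rewrite lg tens_linearr.
by move=> j; rewrite tens_bas /tensmap linext_bas.
Qed.

Lemma tens_suml (I J K : finType) (F : K -> {ffun I -> k^o})
    (y : {ffun J -> k^o}) :
  tens (\sum_i F i) y = \sum_i tens (F i) y.
Proof.
apply/ffunP => p; rewrite !(ffunE, sum_ffunE) mulr_suml.
by apply: eq_bigr => i _; rewrite ffunE.
Qed.

Lemma tens_sumr (I J K : finType) (x : {ffun I -> k^o})
    (F : K -> {ffun J -> k^o}) :
  tens x (\sum_i F i) = \sum_i tens x (F i).
Proof.
apply/ffunP => p; rewrite !(ffunE, sum_ffunE) mulr_sumr.
by apply: eq_bigr => i _; rewrite ffunE.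
Qed.

Lemma tensmap_id (I J : finType) (t : {ffun I * J -> k^o}) : tensmap id id t = t.
Proof.
apply: (eq_on_bas (f := tensmap id id) (g := id)) => //; first exact: linearP.
by move=> [i j]; rewrite /tensmap linext_bas tens_bas.
Qed.

Lemma tensmap_comp (I J I' J' I'' J'' : finType)
    (f : {ffun I -> k^o} -> {ffun I' -> k^o}) (g : {ffun J -> k^o} -> {ffun J' -> k^o})
    (f' : {ffun I' -> k^o} -> {ffun I'' -> k^o})
    (g' : {ffun J' -> k^o} -> {ffun J'' -> k^o}) t :
  linear f' -> linear g' ->
  tensmap (f' \o f) (g' \o g) t = tensmap f' g' (tensmap f g t).
Proof.
move=> lf lg; apply: (eq_on_bas (f := tensmap (f' \o f) (g' \o g))
  (g := fun t => tensmap f' g' (tensmap f g t))); first exact: linearP.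
  by move=> a u v; rewrite !linearP.
by move=> [i j]; rewrite {1 3}/tensmap !linext_bas /= tensmap_tens.
Qed.

End FreeModule.

Arguments bas {k I} i.

(* This alias of {ffun gT * gT -> k^o}, with e_g # h = bas (g, h), hides the  *)
(* pointwise product that {ffun _ -> _} carries.                              *)
Definition drinfeld (k : fieldType) (gT : finGroupType) : Type :=
  {ffun gT * gT -> k^o}.

Section Drinfeld.
Variables (k : fieldType) (gT : finGroupType).
Local Notation D := (drinfeld k gT).

HB.instance Definition _ := GRing.Lmodule.copy D {ffun gT * gT -> k^o}.

Definition smash (g h : gT) : D := bas (g, h).

Local Notation "g '#' h" := (smash g h) (at level 39, no associativity).

Definition dmul_bas (p q : gT * gT) : D :=
  if p.1 == (p.2 * q.1 * p.2^-1)%g then p.1 # (p.2 * q.2)%g else 0.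

Definition dmul (x y : D) : D :=
  linext (fun p => linext (fun q => dmul_bas p q) y) x.

Definition dunit : D := \sum_g g # 1%g.

(* The coproduct of e_g in (k^G)^cop is the sum over ab = g of e_b (x) e_a. *)
Definition dcomul : D -> {ffun (gT * gT) * (gT * gT) -> k^o} :=
  linext (fun p =>
    \sum_(ab : gT * gT | (ab.1 * ab.2)%g == p.1)
       tens (ab.2 # p.2) (ab.1 # p.2)).

Definition dcounit : D -> k^o := linext (fun p => (p.1 == 1%g)%:R : k^o).

(* S (e_g # h) = (1 # h^-1) (e_(g^-1) # 1) *)
Definition dantipode : D -> D :=
  linext (fun p => (p.2^-1 * p.1^-1 * p.2)%g # (p.2^-1)%g).

HB.instance Definition _ :=
  GRing.Linear.copy dcomul (linext (fun p =>
    \sum_(ab : gT * gT | (ab.1 * ab.2)%g == p.1)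
       tens (ab.2 # p.2) (ab.1 # p.2))).
HB.instance Definition _ :=
  GRing.Linear.copy dcounit (linext (fun p => (p.1 == 1%g)%:R : k^o)).
HB.instance Definition _ :=
  GRing.Linear.copy dantipode
    (linext (fun p => (p.2^-1 * p.1^-1 * p.2)%g # (p.2^-1)%g)).

Lemma dmul_linearl y : linear (dmul^~ y).
Proof. exact: linearP. Qed.

Lemma dmul_linearr x : linear (dmul x).
Proof.
move=> a u v; rewrite /dmul /linext scaler_sumr -big_split /=.
apply: eq_bigr => p _; rewrite -/(linext _ _) -/(linext _ u) -/(linext _ v).
by rewrite linearP scalerDr !scalerA mulrC.
Qed.

Lemma dmul_smash g g' h h' : dmul (g # g') (h # h') =
  if g == (g' * h * g'^-1)%g then g # (g' * h')%g else 0.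
Proof. by rewrite /dmul !linext_bas. Qed.

Lemma eq_on_smash (V : lmodType k) (f f' : D -> V) :
  linear f -> linear f' -> (forall g h, f (g # h) = f' (g # h)) -> f =1 f'.
Proof. by move=> lf lf' ff'; apply: eq_on_bas => // -[g h]; exact: ff'. Qed.

Lemma dmul0x y : dmul 0 y = 0.
Proof.
by have := dmul_linearl y (-1) 0 0; rewrite !scaleN1r oppr0 addr0 addNr.
Qed.

Lemma dmulx0 x : dmul x 0 = 0.
Proof.
by have := dmul_linearr x (-1) 0 0; rewrite !scaleN1r oppr0 addr0 addNr.
Qed.

Lemma dmulA : associative dmul.
Proof.
move=> x y z.
apply: (eq_on_smash (f := fun x => dmul x (dmul y z))
                    (f' := fun x => dmul (dmul x y) z)) => [||g g'].
- exact: dmul_linearl.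
- by move=> a u v; rewrite !dmul_linearl.
apply: (eq_on_smash (f := fun y => dmul (g # g') (dmul y z))
                    (f' := fun y => dmul (dmul (g # g') y) z)) => [||h h'].
- by move=> a u v; rewrite dmul_linearl dmul_linearr.
- by move=> a u v; rewrite dmul_linearr dmul_linearl.
apply: (eq_on_smash (f := fun z => dmul (g # g') (dmul (h # h') z))
                    (f' := fun z => dmul (dmul (g # g') (h # h')) z)) => [||l l'].
- by move=> a u v; rewrite !dmul_linearr.
- by move=> a u v; rewrite !dmul_linearr.
rewrite !dmul_smash (fun_if (dmul (g # g'))) (fun_if (dmul^~ (l # l'))).
rewrite dmulx0 dmul0x !dmul_smash.
case: (g =P _) => [->|_]; last by rewrite if_same.
rewrite invMg !mulgA (inj_eq (mulIg _)) -!mulgA (inj_eq (mulgI _)) !mulgA.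
by case: eqP.
Qed.

Lemma dmul1x : left_id dunit dmul.
Proof.
apply: eq_on_smash => [||g h]; [exact: dmul_linearr|by []|].
have dsum y : dmul dunit y = \sum_g dmul (g # 1%g) y.
  pose F : {linear _ -> _} := HB.pack (dmul^~ y)
    (GRing.isLinear.Build _ _ _ _ _ (dmul_linearl y)).
  by rewrite -[LHS]/(F dunit) linear_sum.
rewrite dsum (bigD1 g) //= dmul_smash mul1g invg1 mulg1 eqxx mul1g.
rewrite big1 ?addr0 // => a /negPf ag.
by rewrite dmul_smash mul1g invg1 mulg1 ag.
Qed.

Lemma dmulx1 : right_id dunit dmul.
Proof.
apply: (eq_on_smash (f := dmul^~ dunit)) => [||g h]; [exact: dmul_linearl|by []|].
have dsum y : dmul y dunit = \sum_g dmul y (g # 1%g).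
  pose F : {linear _ -> _} := HB.pack (dmul y)
    (GRing.isLinear.Build _ _ _ _ _ (dmul_linearr y)).
  by rewrite -[LHS]/(F dunit) linear_sum.
rewrite dsum (bigD1 (h^-1 * g * h)%g) //= dmul_smash !mulgA mulgV mul1g mulgK.
rewrite eqxx mulg1 big1 ?addr0 // => a ah; rewrite dmul_smash.
case: ifP => // /eqP ga; case/eqP: ah.
by rewrite ga !mulgA mulVg mul1g mulgKV.
Qed.

Lemma dmulDl : left_distributive dmul +%R.
Proof.
by move=> x y z; have := dmul_linearl z 1 x y; rewrite !scale1r.
Qed.

Lemma dmulDr : right_distributive dmul +%R.
Proof.
by move=> x y z; have := dmul_linearr x 1 y z; rewrite !scale1r.
Qed.

Lemma dunit_neq0 : dunit != 0.
Proof.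
apply/eqP => /ffunP/(_ (1%g, 1%g)); rewrite sum_ffunE (bigD1 1%g) //= !ffunE.
rewrite eqxx big1 ?addr0 => [|a /negPf a1]; first exact/eqP/oner_neq0.
by rewrite ffunE xpair_eqE eq_sym a1.
Qed.

HB.instance Definition _ := GRing.Zmodule_isNzRing.Build D
  dmulA dmul1x dmulx1 dmulDl dmulDr dunit_neq0.

Lemma dscaleAl (a : k) (x y : D) : a *: (x * y) = (a *: x) * y.
Proof.
have := dmul_linearl y a x 0.
by rewrite /= addr0 dmul0x addr0 => /esym.
Qed.

HB.instance Definition _ := GRing.Lmodule_isLalgebra.Build k D dscaleAl.

Lemma dscaleAr (a : k) (x y : D) : a *: (x * y) = x * (a *: y).
Proof.
have := dmul_linearr x a y 0.
by rewrite /= addr0 dmulx0 addr0 => /esym.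
Qed.

HB.instance Definition _ := GRing.Lalgebra_isAlgebra.Build k D dscaleAr.

Lemma smashM g g' h h' : (g # g') * (h # h') =
  if g == (g' * h * g'^-1)%g then g # (g' * h')%g else 0.
Proof. exact: dmul_smash. Qed.

Lemma dunit_sum : 1 = \sum_g g # 1%g :> D.
Proof. by []. Qed.

Lemma dcomul_smash g h : dcomul (g # h) =
  \sum_b tens (b # h) ((g * b^-1)%g # h).
Proof.
rewrite /dcomul linext_bas /= -(pair_big_dep xpredT
  (fun a b => (a * b)%g == g) (fun a b => tens (b # h) (a # h))) /=.
rewrite (exchange_big_dep xpredT) //=; apply: eq_bigr => b _.
rewrite (big_pred1 (g * b^-1)%g) // => a.
by apply/eqP/eqP => [<-|->]; rewrite ?mulgK ?mulgKV.
Qed.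

Lemma dcounit_smash g h : dcounit (g # h) = (g == 1%g)%:R.
Proof. by rewrite /dcounit linext_bas. Qed.

Lemma dantipode_smash g h :
  dantipode (g # h) = (h^-1 * g^-1 * h)%g # (h^-1)%g.
Proof. by rewrite /dantipode linext_bas. Qed.

Lemma comul_linear : linear dcomul. Proof. exact: linearP. Qed.
Lemma counit_linear : linear dcounit. Proof. exact: linearP. Qed.
Lemma antipode_linear : linear dantipode. Proof. exact: linearP. Qed.

Lemma drinfeld_counitl x :
  linext (fun p => dcounit (bas p.1) *: bas p.2) (dcomul x) = x.
Proof.
move: x; apply: eq_on_smash => // [a u v|g h].
  by rewrite !linearP.
rewrite dcomul_smash linear_sum (bigD1 1%g) //= tens_bas linext_bas.
rewrite -/(smash _ _) dcounit_smash eqxx scale1r invg1 mulg1.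
rewrite big1 ?addr0 // => b /negPf b1.
by rewrite tens_bas linext_bas -/(smash _ _) dcounit_smash b1 scale0r.
Qed.

Lemma drinfeld_counitr x :
  linext (fun p => dcounit (bas p.2) *: bas p.1) (dcomul x) = x.
Proof.
move: x; apply: eq_on_smash => // [a u v|g h].
  by rewrite !linearP.
rewrite dcomul_smash linear_sum (bigD1 g) //= tens_bas linext_bas.
rewrite -/(smash _ _) dcounit_smash mulgV eqxx scale1r.
rewrite big1 ?addr0 // => b /negPf bg.
rewrite tens_bas linext_bas -/(smash _ _) dcounit_smash.
by rewrite -eq_mulgV1 eq_sym bg scale0r.
Qed.

Lemma drinfeld_coassoc x :
  tensmap dcomul id (dcomul x) =
  linext (fun p => bas ((p.1, p.2.1), p.2.2)) (tensmap id dcomul (dcomul x)).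
Proof.
move: x; apply: eq_on_smash => [a u v|a u v|g h].
- by rewrite !linearP.
- by rewrite !linearP.
rewrite dcomul_smash [tensmap id dcomul _]linear_sum [tensmap dcomul id _]linear_sum.
rewrite [RHS]linear_sum /=.
transitivity (\sum_b \sum_c
  tens (tens (c # h) ((b * c^-1)%g # h)) ((g * b^-1)%g # h)).
  apply: eq_bigr => b _; rewrite tensmap_tens //; last exact: comul_linear.
  by rewrite dcomul_smash tens_suml.
rewrite exchange_big; apply: eq_bigr => c _ /=.
rewrite tensmap_tens //; last exact: comul_linear.
rewrite dcomul_smash tens_sumr linear_sum (reindex_inj (mulIg c)) /=.
apply: eq_bigr => b _.
by rewrite !tens_bas linext_bas /= mulgK invMg mulgA.
Qed.

Lemma drinfeld_counit1 : dcounit 1 = 1.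
Proof.
rewrite dunit_sum linear_sum (bigD1 1%g) //= dcounit_smash eqxx big1 ?addr0 //.
by move=> g /negPf g1; rewrite dcounit_smash g1.
Qed.

Lemma linext_mul (f f' : D -> D) g h g' h' :
  linext (fun p => f (bas p.1) * f' (bas p.2) : D) (tens (g # h) (g' # h')) =
  f (g # h) * f' (g' # h').
Proof. by rewrite tens_bas linext_bas. Qed.

Lemma drinfeld_antipodel x :
  linext (fun p => dantipode (bas p.1) * bas p.2 : D) (dcomul x) =
  (dcounit x : k) *: 1.
Proof.
move: x; apply: eq_on_smash => [a u v|a u v|g h].
- by rewrite !linearP.
- by rewrite linearP scalerDl -scalerA.
rewrite dcomul_smash linear_sum dcounit_smash /=.
transitivity (\sum_b if g == 1%g then (h^-1 * b^-1 * h)%g # 1%g else 0 : D).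
  apply: eq_bigr => b _; rewrite (linext_mul dantipode id) dantipode_smash smashM.
  rewrite !invgK -!mulgA (inj_eq (mulgI _)) !mulgA (inj_eq (mulIg _)).
  by rewrite eq_sym -[X in _ == X]mul1g (inj_eq (mulIg _)) mulVg.
case: (g == 1%g); last by rewrite big1 ?scale0r.
rewrite scale1r dunit_sum [in RHS](reindex_inj invg_inj) /=.
by rewrite [in RHS](reindex_inj (conjg_inj h)) /=; under [in RHS]eq_bigr => b _ do
  rewrite conjgE !invMg invgK.
Qed.

Lemma drinfeld_antipoder x :
  linext (fun p => (bas p.1 : D) * dantipode (bas p.2)) (dcomul x) =
  (dcounit x : k) *: 1.
Proof.
move: x; apply: eq_on_smash => [a u v|a u v|g h].
- by rewrite !linearP.
- by rewrite linearP scalerDl -scalerA.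
rewrite dcomul_smash linear_sum dcounit_smash /=.
transitivity (\sum_b if g == 1%g then b # 1%g else 0 : D).
  apply: eq_bigr => b _.
  apply: etrans (linext_mul id dantipode _ _ _ _) _ => /=.
  rewrite dantipode_smash smashM.
  rewrite invMg invgK !mulgA mulgV mul1g mulgK -[X in X == _]mulg1.
  by rewrite (inj_eq (mulgI _)) eq_sym eq_invg1.
case: (g == 1%g); last by rewrite big1 ?scale0r.
by rewrite scale1r dunit_sum.
Qed.

Definition tensmul (t u : {ffun (gT * gT) * (gT * gT) -> k^o}) :
    {ffun (gT * gT) * (gT * gT) -> k^o} :=
  linext (fun p => linext (fun q =>
    tens ((bas p.1 : D) * bas q.1) ((bas p.2 : D) * bas q.2)) u) t.

Lemma drinfeld_comulM (x y : D) :
  dcomul (x * y) = tensmul (dcomul x) (dcomul y).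
Proof.
move: x; apply: eq_on_smash => [a u v|a u v|g g'].
- by rewrite [_ * y]dmul_linearl linearP.
- by rewrite linearP /tensmul linearP.
move: y; apply: eq_on_smash => [a u v|a u v|h h'].
- by rewrite [_ * _]dmul_linearr linearP.
- rewrite linearP /tensmul /linext scaler_sumr -big_split /=.
  apply: eq_bigr => p _; rewrite -!/(linext _ _).
  by rewrite linearP scalerDr !scalerA mulrC.
rewrite [dcomul (g # g')]dcomul_smash /tensmul [in RHS]linear_sum /=.
transitivity (\sum_b \sum_c
  tens ((b # g') * (c # h')) (((g * b^-1)%g # g') * ((h * c^-1)%g # h'))).
  rewrite smashM; case: ifP => [/eqP gE|gE].
    rewrite dcomul_smash; apply: eq_bigr => b _.
    rewrite (bigD1 (g'^-1 * b * g')%g) //= !smashM !invMg invgK !mulgA.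
    rewrite mulgV mul1g !mulgK -gE !eqxx.
    rewrite big1 ?addr0 // => c cb; rewrite smashM ifF.
      by apply/ffunP => p; rewrite !ffunE mul0r.
    by apply/eqP => bE; case/eqP: cb; rewrite bE !mulgA mulVg mul1g mulgKV.
  rewrite linear0 big1 // => b _; rewrite big1 // => c _; rewrite !smashM.
  case: ifP => [/eqP bE|_]; last by apply/ffunP => p; rewrite !ffunE mul0r.
  rewrite ifF; first by apply/ffunP => p; rewrite !ffunE mulr0.
  apply/eqP => gbE; case/eqP: gE; rewrite -[g](mulgKV b) gbE bE !mulgA.
  by rewrite mulgKV mulgKV.
apply: eq_bigr => b _; rewrite [in RHS]tens_bas linext_bas dcomul_smash linear_sum /=.
by apply: eq_bigr => c _; rewrite [in RHS]tens_bas linext_bas.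
Qed.

Lemma drinfeld_comul1 : dcomul 1 = tens (1 : D) (1 : D).
Proof.
rewrite dunit_sum linear_sum tens_suml.
transitivity (\sum_g \sum_b tens (b # 1%g) ((g * b^-1)%g # 1%g)).
  by apply: eq_bigr => g _; rewrite -dcomul_smash.
rewrite exchange_big; apply: eq_bigr => b _ /=.
rewrite tens_sumr (reindex_inj (mulIg b)) /=.
by apply: eq_bigr => a _; rewrite mulgK.
Qed.

Lemma drinfeld_counitM (x y : D) :
  dcounit (x * y) = (dcounit x : k) * (dcounit y : k).
Proof.
move: x; apply: (eq_on_smash (V := k^o)) => [a u v|a u v|g g'].
- by rewrite [_ * y]dmul_linearl linearP.
- by rewrite linearP regscaleE mulrDl -mulrA.
move: y; apply: (eq_on_smash (V := k^o)) => [a u v|a u v|h h'].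
- by rewrite [_ * _]dmul_linearr linearP.
- by rewrite linearP !regscaleE mulrDr mulrCA.
rewrite smashM (fun_if dcounit) linear0 !dcounit_smash.
case: (g =P 1%g) => [->|_]; last by rewrite mul0r if_same.
rewrite mul1r eq_sym -eq_mulgV1 -[X in _ == X]mulg1.
by rewrite (inj_eq (mulgI _)); case: eqP.
Qed.

Record is_hopf_aut (f : D -> D) : Prop := IsHopfAut {
  hopf_aut_linear : linear f;
  hopf_aut_bij : bijective f;
  hopf_aut1 : f 1 = 1;
  hopf_autM : forall x y, f (x * y) = f x * f y;
  hopf_aut_comul : forall x, dcomul (f x) = tensmap f f (dcomul x);
  hopf_aut_counit : forall x, dcounit (f x) = dcounit x;
  hopf_aut_antipode : forall x, dantipode (f x) = f (dantipode x)
}.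

Record hopfAut : Type := HopfAut {
  hopf_fun :> D -> D;
  hopf_funP : is_hopf_aut hopf_fun
}.

Lemma hopfAutP (f f' : hopfAut) : f =1 f' -> f = f'.
Proof.
case: f f' => [f fP] [f' f'P] /= /funext ff'.
by subst f'; congr HopfAut; exact: Prop_irrelevance.
Qed.

Lemma is_hopf_aut_id : is_hopf_aut id.
Proof. by split => // [|x]; [exists id | rewrite tensmap_id]. Qed.

Lemma is_hopf_aut_comp (f f' : D -> D) :
  is_hopf_aut f -> is_hopf_aut f' -> is_hopf_aut (f' \o f).
Proof.
move=> [lf bf f1 fM fD fe fS] [lf' bf' f1' fM' fD' fe' fS'].
split => /= [a u v||||x|x|x]; first by rewrite /= lf lf'.
- exact: bij_comp.
- by rewrite f1.
- by move=> x y; rewrite fM fM'.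
- by rewrite fD' fD (tensmap_comp f f (f' := f') (g' := f')).
- by rewrite fe' fe.
- by rewrite fS' fS.
Qed.

Lemma is_hopf_aut_inv (f f' : D -> D) :
  is_hopf_aut f -> cancel f f' -> cancel f' f -> is_hopf_aut f'.
Proof.
move=> [lf bf f1 fM fD fe fS] ff' f'f.
have lf' : linear f' by move=> a u v; apply: (can_inj ff'); rewrite lf !f'f.
split => // [||x y|x|x|x].
- by exists f.
- by rewrite -f1 ff'.
- by apply: (can_inj ff'); rewrite fM !f'f.
- rewrite -{2}[x]f'f fD -(tensmap_comp f f (f' := f') (g' := f')) //.
  have -> : f' \o f = id by apply/funext => u; exact: ff'.
  by rewrite tensmap_id.
- by rewrite -{2}[x]f'f fe.
- by apply: (can_inj ff'); rewrite -fS !f'f.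
Qed.

Lemma hopfAut_inv_ex (f : hopfAut) :
  exists f' : hopfAut, cancel f f' /\ cancel f' f.
Proof.
have [f' ff' f'f] := hopf_aut_bij (hopf_funP f).
by exists (HopfAut (is_hopf_aut_inv (hopf_funP f) ff' f'f)).
Qed.

Definition hopfAut_one : hopfAut := HopfAut is_hopf_aut_id.

(* As for permutations, products are written in diagrammatic order:           *)
(* (f * f') x = f' (f x).                                                     *)
Definition hopfAut_mul (f f' : hopfAut) : hopfAut :=
  HopfAut (is_hopf_aut_comp (hopf_funP f) (hopf_funP f')).

Definition hopfAut_inv (f : hopfAut) : hopfAut :=
  projT1 (cid (hopfAut_inv_ex f)).

Lemma hopfAut_mulA : associative hopfAut_mul.
Proof. by move=> f f' f''; apply: hopfAutP. Qed.

Lemma hopfAut_mul1 : left_id hopfAut_one hopfAut_mul.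
Proof. by move=> f; apply: hopfAutP. Qed.

Lemma hopfAut_mulr1 : right_id hopfAut_one hopfAut_mul.
Proof. by move=> f; apply: hopfAutP. Qed.

Lemma hopfAut_mulV : left_inverse hopfAut_one hopfAut_inv hopfAut_mul.
Proof.
move=> f; apply: hopfAutP => x /=.
by rewrite /hopfAut_inv; case: cid => f' /= [_ f'f]; exact: f'f.
Qed.

Lemma hopfAut_mulrV : right_inverse hopfAut_one hopfAut_inv hopfAut_mul.
Proof.
move=> f; apply: hopfAutP => x /=.
by rewrite /hopfAut_inv; case: cid => f' /= [ff' _]; exact: ff'.
Qed.

HB.instance Definition _ := gen_eqMixin hopfAut.
HB.instance Definition _ := gen_choiceMixin hopfAut.
HB.instance Definition _ := isGroup.Build hopfAut
  hopfAut_mulA hopfAut_mul1 hopfAut_mulr1 hopfAut_mulV hopfAut_mulrV.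

Definition twistr (w : gT -> gT) : D -> D := linext (fun p => p.1 # w p.2).

Definition twistl (w : gT -> gT) : D -> D := linext (fun p => w p.1 # p.2).

End Drinfeld.

Arguments smash {k gT} g h.
Arguments twistr {k gT} w x.
Arguments twistl {k gT} w x.

Section CentralAut.
Variable gT : finGroupType.

Definition Autc : {set {perm gT}} :=
  [set w in Aut [set: gT] | [forall g, (w g * g^-1)%g \in 'Z([set: gT])%g]].

Lemma Autc_group_set : group_set Autc.
Proof.
apply/group_setP; split=> [|u v].
  rewrite inE group1; apply/forallP => g; rewrite perm1 mulgV; exact: group1.
rewrite ![_ \in Autc]inE => /andP[uA /forallP uZ] /andP[vA /forallP vZ].
rewrite groupM //; apply/forallP => g; rewrite permM.
by rewrite -(mulgKV (u g) (v (u g))) -mulgA groupM.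
Qed.

Canonical Autc_group : {group {perm gT}} := group Autc_group_set.

End CentralAut.

Arguments Autc gT : clear implicits.

(* Main.v *)
(* Both families are instances of e_g # h |-> e_(u g) # v h with u and v       *)
(* central automorphisms of G. As u h and v h differ from h by a central       *)
(* element, u, v and the identity induce the same conjugation, and             *)
(* conjugation is all that the product and the antipode use besides the group  *)
(* law. Evaluation on the basis recovers u and v, so the pairs (u, v) embed    *)
(* into Aut(D(G)); the two copies of Aut_c(G) are the coordinate axes.         *)

From HB Require Import structures.
Require Import Defs.
From mathcomp Require Import all_boot all_fingroup all_algebra.
From mathcomp Require Import center.
From mathcomp Require Import boolp classical_sets.

Set Implicit Arguments.
Unset Strict Implicit.
Unset Printing Implicit Defensive.

Import GRing.Theory.
Local Open Scope classical_set_scope.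
Local Open Scope ring_scope.

(** Both maps are cases of [twist u v] with one coordinate trivial, so a single check of the Hopf
    axioms, [twist_hopf_aut], serves both. Unit, coproduct and counit only need [u] and [v] to be
    automorphisms. Centrality enters through [Autc_conj], which lets [u] and [v] act independently
    in the product and the antipode. By [twist_inj] the map determines [u] and [v]; this gives
    injectivity, and since the two axes meet only at the identity ([twistr_eq_twistl]), also
    distinctness and the trivial intersection. *)

Section CentralAutTheory.
Variables (gT : finGroupType) (w : {perm gT}).
Hypothesis wA : w \in Autc gT.
Implicit Types g h : gT.

Lemma AutcM : {morph w : g h / (g * h)%g}.
Proof.
move: wA; rewrite inE => /andP[wG _] g h.
by have /morphicP-> := Aut_morphic wG; rewrite ?inE.
Qed.

Lemma Autc1 : w 1%g = 1%g.
Proof. by apply: (mulgI (w 1%g)); rewrite -AutcM !mulg1. Qed.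

Lemma AutcV : {morph w : g / (g^-1)%g}.
Proof. by move=> g; apply: (mulgI (w g)); rewrite -AutcM !mulgV Autc1. Qed.

Lemma Autc_eq1 g : (w g == 1%g) = (g == 1%g).
Proof. by rewrite -{1}Autc1 (inj_eq perm_inj). Qed.

(** Write [w h] as [(w h * h^-1) * h]: the first factor is central, so conjugation by it fixes
    [g]. *)
Lemma Autc_conj g h : (g ^ w h)%g = (g ^ h)%g.
Proof.
move: wA; rewrite inE => /andP[_ /forallP/(_ h)/centerP[_ wZ]].
rewrite -{1}(mulgKV h (w h)) conjgM; congr (_ ^ _)%g.
by apply/conjg_fixP/commgP/commute_sym/wZ; rewrite inE.
Qed.

Lemma AutcJ g h : w (g ^ h)%g = (w g ^ h)%g.
Proof. by rewrite !conjgE !AutcM AutcV -!conjgE Autc_conj. Qed.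

End CentralAutTheory.

Section Twist.
Variables (k : fieldType) (gT : finGroupType).
Local Notation D := (drinfeld k gT).
Implicit Types u v w : {perm gT}.

Lemma smash_inj (g h g' h' : gT) :
  smash g h = smash g' h' :> D -> g = g' /\ h = h'.
Proof.
move=> /ffunP/(_ (g, h)); rewrite !ffunE eqxx.
by case: eqP => [[-> ->] //|_ /eqP]; rewrite oner_eq0.
Qed.

(** Arbitrary functions are allowed, so that [id] and composites are literal instances. *)
Definition twist (a b : gT -> gT) : D -> D :=
  linext (fun p => smash (a p.1) (b p.2)).

Lemma twist_linear (a b : gT -> gT) : linear (twist a b).
Proof. exact: linearP. Qed.

Lemma twist_sum (a b : gT -> gT) (I : finType) (F : I -> D) :
  twist a b (\sum_i F i) = \sum_i twist a b (F i).
Proof. exact: linear_sum. Qed.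

Lemma twist_smash (a b : gT -> gT) (g h : gT) :
  twist a b (smash g h) = smash (a g) (b h).
Proof. by rewrite /twist linext_bas. Qed.

Lemma twistrE (w : gT -> gT) : twistr w = twist id w :> (D -> D).
Proof. by []. Qed.

Lemma twistlE (w : gT -> gT) : twistl w = twist w id :> (D -> D).
Proof. by []. Qed.

Lemma eq_twist (a b a' b' : gT -> gT) :
  a =1 a' -> b =1 b' -> twist a b = twist a' b'.
Proof. by move=> /funext-> /funext->. Qed.

Lemma twist_inj (a b a' b' : gT -> gT) :
  twist a b = twist a' b' -> a =1 a' /\ b =1 b'.
Proof.
move=> eq_t; have eqab g h : a g = a' g /\ b h = b' h.
  by apply: smash_inj; rewrite -!twist_smash eq_t.
by split=> x; have [] := eqab x x.
Qed.

Lemma twist_id : twist id id = id.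
Proof.
apply/funext; apply: eq_on_smash => // [|g h]; first exact: twist_linear.
by rewrite twist_smash.
Qed.

Lemma twist_comp (a b a' b' : gT -> gT) :
  twist a' b' \o twist a b = twist (a' \o a) (b' \o b).
Proof.
apply/funext; apply: eq_on_smash => [c x y||g h].
- by rewrite /= !twist_linear.
- exact: twist_linear.
by rewrite /= !twist_smash.
Qed.

Lemma twist_bij u v : bijective (twist u v).
Proof.
exists (twist (u^-1)%g (v^-1)%g) => x.
  rewrite -[LHS]/((twist _ _ \o twist _ _) x) twist_comp -[RHS]/(id x) -twist_id.
  by congr (_ x); apply: eq_twist => g /=; rewrite permK.
rewrite -[LHS]/((twist _ _ \o twist _ _) x) twist_comp -[RHS]/(id x) -twist_id.
by congr (_ x); apply: eq_twist => g /=; rewrite permKV.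
Qed.

Section Central.
Variables u v : {perm gT}.
Hypotheses (uA : u \in Autc gT) (vA : v \in Autc gT).

Lemma twist1 : twist u v 1 = 1.
Proof.
(* [u] permutes the summands of the unit. *)
rewrite !dunit_sum twist_sum [RHS](reindex_inj (perm_inj (s := u))) /=.
by apply: eq_bigr => g _; rewrite twist_smash (Autc1 vA).
Qed.

Lemma twistM (x y : D) : twist u v (x * y) = twist u v x * twist u v y.
Proof.
move: x; apply: eq_on_smash => [c s t|c s t|g g'].
- by rewrite [_ * y]dmul_linearl twist_linear.
- by rewrite twist_linear [LHS]dmul_linearl.
move: y; apply: eq_on_smash => [c s t|c s t|h h'].
- by rewrite [_ * _]dmul_linearr twist_linear.
- by rewrite twist_linear [LHS]dmul_linearr.
(* In conjugation form, [Autc_conj] drops [v] and [AutcJ] pulls [u] out, so the test for a nonzero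
   product becomes the original one with [u] applied to both sides. *)
have conjE (a b : gT) : (a * b * a^-1)%g = (b ^ a^-1)%g.
  by rewrite conjgE invgK mulgA.
rewrite !twist_smash !smashM !conjE -(AutcV vA) (Autc_conj vA) -(AutcJ uA).
rewrite (inj_eq perm_inj); case: eqP => _; first by rewrite twist_smash (AutcM vA).
exact: (linear0 (linext _)).
Qed.

Lemma twist_comul (x : D) :
  dcomul (twist u v x) = tensmap (twist u v) (twist u v) (dcomul x).
Proof.
move: x; apply: eq_on_smash => [c s t|c s t|g h].
- by rewrite twist_linear linearP.
- by rewrite !linearP.
rewrite twist_smash !dcomul_smash linear_sum.
(* The factorizations of [u g] are the images under [u] of those of [g]. *)
rewrite [LHS](reindex_inj (perm_inj (s := u))) /=; apply: eq_bigr => b _.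
rewrite tensmap_tens; try exact: twist_linear.
by rewrite !twist_smash (AutcM uA) (AutcV uA).
Qed.

Lemma twist_counit (x : D) : dcounit (twist u v x) = dcounit x.
Proof.
move: x; apply: (eq_on_smash (V := k^o)) => [c s t||g h].
- by rewrite twist_linear linearP.
- exact: linearP.
by rewrite twist_smash !dcounit_smash (Autc_eq1 uA).
Qed.

Lemma twist_antipode (x : D) :
  dantipode (twist u v x) = twist u v (dantipode x).
Proof.
move: x; apply: eq_on_smash => [c s t|c s t|g h].
- by rewrite twist_linear linearP.
- by rewrite linearP twist_linear.
(* The first leg of the antipode is [g^-1 ^ h], so the conjugation lemmas apply again. *)
rewrite twist_smash !dantipode_smash twist_smash -!mulgA -!conjgE.
by rewrite (Autc_conj vA) (AutcJ uA) (AutcV uA) (AutcV vA).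
Qed.

Lemma twist_hopf_aut : is_hopf_aut (twist u v).
Proof.
split.
- exact: twist_linear.
- exact: twist_bij.
- exact: twist1.
- exact: twistM.
- exact: twist_comul.
- exact: twist_counit.
- exact: twist_antipode.
Qed.

End Central.

Lemma twist_perm1l w : twist (1%g : {perm gT}) w = twistr w.
Proof. by rewrite twistrE; apply: eq_twist => // g; rewrite perm1. Qed.

Lemma twist_perm1r w : twist w (1%g : {perm gT}) = twistl w.
Proof. by rewrite twistlE; apply: eq_twist => // g; rewrite perm1. Qed.

Lemma twistr_hopf_aut w : w \in Autc gT -> is_hopf_aut (twistr w : D -> D).
Proof. by move=> wA; rewrite -twist_perm1l; apply: twist_hopf_aut => //; exact: group1. Qed.

Lemma twistl_hopf_aut w : w \in Autc gT -> is_hopf_aut (twistl w : D -> D).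
Proof. by move=> wA; rewrite -twist_perm1r; apply: twist_hopf_aut => //; exact: group1. Qed.

Lemma twistr_inj u v : twistr u = twistr v :> (D -> D) -> u = v.
Proof. by rewrite !twistrE => /twist_inj[_ /permP]. Qed.

Lemma twistl_inj u v : twistl u = twistl v :> (D -> D) -> u = v.
Proof. by rewrite !twistlE => /twist_inj[/permP]. Qed.

Lemma twistr_eq_twistl u v :
  twistr u = twistl v :> (D -> D) -> u = 1%g /\ v = 1%g.
Proof.
rewrite twistrE twistlE => /twist_inj[idv uid].
by split; apply/permP => g; rewrite perm1 ?uid ?idv.
Qed.

Local Notation AutcT := (subg_of (Autc_group gT)).

Definition twistr_aut (w : AutcT) : hopfAut k gT :=
  HopfAut (twistr_hopf_aut (subgP w)).

Definition twistl_aut (w : AutcT) : hopfAut k gT :=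
  HopfAut (twistl_hopf_aut (subgP w)).

(** Permutations and [hopfAut] both multiply in diagrammatic order, so no reversal occurs. *)
Lemma twistr_autM : {morph twistr_aut : u v / (u * v)%g}.
Proof.
move=> u v; apply: hopfAutP => x /=.
rewrite -[RHS]/((twistr (sgval v) \o twistr (sgval u)) x) !twistrE twist_comp.
by congr (_ x); apply: eq_twist => // g; rewrite /= permM.
Qed.

Lemma twistl_autM : {morph twistl_aut : u v / (u * v)%g}.
Proof.
move=> u v; apply: hopfAutP => x /=.
rewrite -[RHS]/((twistl (sgval v) \o twistl (sgval u)) x) !twistlE twist_comp.
by congr (_ x); apply: eq_twist => // g; rewrite /= permM.
Qed.

Lemma twistr_aut1 : twistr_aut 1%g = 1%g.
Proof. by apply: (mulgI (twistr_aut 1%g)); rewrite -twistr_autM !mulg1. Qed.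

HB.instance Definition _ :=
  isMultiplicative.Build AutcT (hopfAut k gT) twistr_aut twistr_autM.
Lemma twistl_aut1 : twistl_aut 1%g = 1%g.
Proof. by apply: (mulgI (twistl_aut 1%g)); rewrite -twistl_autM !mulg1. Qed.

HB.instance Definition _ :=
  isMultiplicative.Build AutcT (hopfAut k gT) twistl_aut twistl_autM.

End Twist.

Theorem proposition4p5 (k : closedFieldType) (chark : [pchar k] =i pred0)
    (gT : finGroupType) :
  (forall w : {perm gT}, w \in Autc gT ->
     is_hopf_aut (twistr w : drinfeld k gT -> drinfeld k gT) /\
     is_hopf_aut (twistl w : drinfeld k gT -> drinfeld k gT)) /\
  exists Phi Psi : {multiplicative subg_of (Autc_group gT) -> hopfAut k gT},
    [/\ forall w, Phi w = twistr (sgval w) :> (drinfeld k gT -> drinfeld k gT),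
        forall w, Psi w = twistl (sgval w) :> (drinfeld k gT -> drinfeld k gT),
        injective Phi /\ injective Psi,
        Autc gT <> 1%g -> (Phi : _ -> _) <> (Psi : _ -> _)
      & range Phi `&` range Psi = [set 1%g]].
Proof.
split=> [w wA|]; first by split; [exact: twistr_hopf_aut|exact: twistl_hopf_aut].
exists (@twistr_aut k gT), (@twistl_aut k gT).
have valE (f f' : hopfAut k gT) : f = f' -> hopf_fun f = hopf_fun f' by move->.
split=> //.
- by split=> u v /valE; [move/twistr_inj|move/twistl_inj]; exact: val_inj.
(* If the two maps agreed, their common value at any [w] would lie on both axes, forcing [w] to be
   trivial. *)
- move=> Autc_neq1 eqPP; apply: Autc_neq1; apply/trivgP/fintype.subsetP => w wA.
  have /valE/twistr_eq_twistl[] := congr1 (@^~ (subg (Autc_group gT) w)) eqPP.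
  by rewrite subgK // => ->; rewrite inE.
apply/seteqP; split=> [f [[u _ <-] [v _ /esym/valE/twistr_eq_twistl[u1 _]]]|f ->].
  have {u1}-> : u = 1%g by exact: val_inj.
  by rewrite /= twistr_aut1.
by split; exists 1%g => //; [exact: twistr_aut1|exact: twistl_aut1].
Qed.
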